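(* Let $\tau$ be a two-valued measurable cardinal, and let $\Omega$ be a metric space with $|\Omega|\ge\tau$. Then the $k$-NN classifier is not universally consistent in $\Omega$.
   Context: A cardinal $\tau$ is two-valued measurable if there is a $\{0,1\}$-valued probability measure on all subsets of $\tau$, vanishing on singletons, whose null ideal is closed under unions of fewer than $\tau$ members. $\Omega$ carries its Borel $\sigma$-algebra, $\Omega\times\{0,1\}$ the product $\sigma$-algebra. A learning rule $\mathcal L$ assigns to each labelled sample $\sigma\in\Omega^n\times\{0,1\}^n$ and $x\in\Omega$ a label $\mathcal L_n(\sigma)(x)\in\{0,1\}$; for a probability $\tilde\mu$ on $\Omega\times\{0,1\}$, $\mathrm{err}_{\tilde\mu}(\mathcal L_n)=(\tilde\mu^n\otimes\tilde\mu)\{(\sigma,x,y):\mathcal L_n(\sigma)(x)\ne y\}$, the Bayes error is $\ell^*(\tilde\mu)=\inf_T\tilde\mu\{(x,y):T(x)\ne y\}$ over measurable $T:\Omega\to\{0,1\}$, and $\mathcal L$ is universally consistent if $\mathrm{err}_{\tilde\mu}(\mathcal L_n)\to\ell^*(\tilde\mu)$ for every probability $\tilde\mu$ on $\Omega\times\{0,1\}$. The $k$-NN classifier: fix $k=k_n$ with $k_n\to\infty$, $k_n/n\to0$; for a sample of size $n\ge k$ and $x\in\Omega$ let $r(x)$ be the least radius such that $\bar B_{r(x)}(x)$ contains at least $k$ sample points; select $k$ sample points consisting of all points at distance $<r(x)$ and points at distance exactly $r(x)$ chosen uniformly at random, independently of the data; predict $1$ iff at least half of the selected points have label $1$.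
   Formalization: The error, whose defining set need not be measurable for the product σ-algebra here (e.g. τ with the 0–1 metric), is taken as an iterated (lower) integral over the sample points in turn and then (x,y), with tie-breaking averaged out; it equals the product-measure error whenever that is defined. *)

(* Defs.v *)
From HB Require Import structures.
From mathcomp Require Import all_boot all_order all_algebra.
From mathcomp Require Import all_classical all_reals all_analysis.
Set Implicit Arguments.
Unset Strict Implicit.
Unset Printing Implicit Defensive.
Import Order.TTheory GRing.Theory Num.Theory.
Import numFieldNormedType.Exports.
Local Open Scope classical_set_scope.
Local Open Scope ring_scope.

Definition type_card_le (A B : Type) : Prop := exists f : A -> B, injective f.
Definition type_card_lt (A B : Type) : Prop := type_card_le A B /\ ~ type_card_le B A.

(* ---------- Two-valued measurable cardinals ----------
   The cardinal tau is represented by any type K of cardinality tau.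
   K is two-valued measurable iff there is a {0,1}-valued probability measure
   nu on all subsets of K, vanishing on singletons, whose null ideal is closed
   under unions of fewer than |K| members. *)
Definition two_valued_measurable (R : realType) (K : Type) : Prop :=
  exists nu : set K -> R,
    [/\ (forall A, nu A = 0 \/ nu A = 1),
        nu setT = 1,
        (forall F : (set K)^nat, trivIset setT F ->
           (fun n => \sum_(0 <= i < n) nu (F i)) @ \oo --> nu (\bigcup_i F i)),
        (forall x, nu [set x] = 0) &
        (forall (I : Type) (A : I -> set K), type_card_lt I K ->
           (forall i, nu (A i) = 0) -> nu (\bigcup_(i in [set: I]) A i) = 0)].

Definition is_metric (R : realType) (T : Type) (dist : T -> T -> R) : Prop :=
  [/\ forall x y, 0 <= dist x y,
      forall x y, dist x y = 0 <-> x = y,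
      forall x y, dist x y = dist y x &
      forall x y z, dist x z <= dist x y + dist y z].

Definition metric_open (R : realType) (T : Type) (dist : T -> T -> R)
  (U : set T) : Prop :=
  forall x, U x -> exists2 e : R, 0 < e & [set y | dist x y < e] `<=` U.

Definition is_borel (R : realType) (d : measure_display) (T : measurableType d)
  (dist : T -> T -> R) : Prop :=
  forall A : set T, measurable A <-> <<s [set U | metric_open dist U] >> A.

(* ---------- The k-NN classifier (with uniform random tie-breaking) ----------
   For a labelled sample s and a query point x, r is the least radius such
   that the closed ball of radius r around x contains at least k sample
   points; all points at distance < r are selected, and k - a of the b points
   at distance exactly r are selected uniformly at random.
   knn_prob1 k s x = probability (over the tie-breaking) that the k-NN rule
   predicts label 1. *)
Section KNN.
Variables (R : realType) (T : Type) (dist : T -> T -> R).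

Definition knn_radius (k : nat) (s : seq (T * bool)) (x : T) : R :=
  inf [set rho : R | 0 <= rho /\ (k <= count (fun z => (dist x z.1 <= rho)%R) s)%N].

Definition knn_prob1 (k : nat) (s : seq (T * bool)) (x : T) : R :=
  let r := knn_radius k s x in
  let a := count (fun z => dist x z.1 < r) s in
  let o1 := count (fun z => (dist x z.1 < r) && z.2) s in
  let b := count (fun z => dist x z.1 == r) s in
  let t1 := count (fun z => (dist x z.1 == r) && z.2) s in
  let t0 := (b - t1)%N in
  let m := (k - a)%N in
  \sum_(0 <= j < m.+1 | (k <= 2 * (o1 + j))%N)
     ('C(t1, j) * 'C(t0, m - j))%:R / ('C(b, m))%:R.

Definition knn_loss (k : nat) (s : seq (T * bool)) (z : T * bool) : R :=
  if z.2 then 1 - knn_prob1 k s z.1 else knn_prob1 k s z.1.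
End KNN.

Fixpoint iter_int (d : measure_display) (T : measurableType d) (R : realType)
  (mu : {measure set T -> \bar R}) (n : nat) (F : seq T -> \bar R) : \bar R :=
  match n with
  | 0 => F [::]
  | n'.+1 => (\int[mu]_z iter_int mu n' (fun s => F (z :: s)))%E
  end.

Definition knn_err (d : measure_display) (T : measurableType d) (R : realType)
  (dist : T -> T -> R) (mu : probability (T * bool)%type R) (k : nat -> nat)
  (n : nat) : \bar R :=
  iter_int mu n (fun s => \int[mu]_z (knn_loss dist (k n) s z)%:E)%E.

Definition bayes_error (d : measure_display) (T : measurableType d)
  (R : realType) (mu : probability (T * bool)%type R) : \bar R :=
  ereal_inf [set mu [set z | f z.1 != z.2] | f in
             [set f : T -> bool | measurable_fun setT f]].

Definition knn_universally_consistent (d : measure_display)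
  (T : measurableType d) (R : realType) (dist : T -> T -> R)
  (k : nat -> nat) : Prop :=
  forall mu : probability (T * bool)%type R,
    knn_err dist mu k n @[n --> \oo] --> bayes_error mu.

(* Main.v *)
Require Import Defs.
From HB Require Import structures.
From mathcomp Require Import all_boot all_order all_algebra.
From mathcomp Require Import all_classical all_reals all_analysis.
From mathcomp Require Import measurable_realfun ring lra.
Import Order.TTheory GRing.Theory Num.Theory.
Import numFieldNormedType.Exports.
Local Open Scope classical_set_scope.
Local Open Scope ring_scope.
Set Implicit Arguments.
Unset Strict Implicit.
Unset Printing Implicit Defensive.

(** Push the two-valued measure to a diffuse {0,1}-valued Borel probability P on
    Omega. Each function dist x is P-a.e. constant, and this constant is a
    nonexpansive function of x, hence itself P-a.e. equal to some r: for almost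
    all x, almost all points lie at distance exactly r from x. Let x0 be such a
    point, and give mass 3/4 to (x0, false) and mass 1/4 to the copy of P with
    label true. The rule "true iff x <> x0" makes no error, so the Bayes error
    vanishes. For almost every query with label true, however, all n sample
    points are tied at distance r, so the classifier votes among k points chosen
    uniformly from the whole sample, and by Markov's inequality it answers true
    with probability at most twice the proportion of labels true. The error is
    therefore at least 1/4 * (1 - 2 * 1/4) = 1/8. *)

(** * Lower bounds for integrals of arbitrary functions *)

(* Without measurability the integral of a nonnegative function is a lower integral, a supremum over simple functions below it; this is what allows bounding the possibly non-measurable integrands of [knn_err]. *)
Lemma le_integral_pointwise d (T : measurableType d) (R : realType)
    (mu : {measure set T -> \bar R}) (f g : T -> \bar R) :
  (forall x, f x <= g x)%E -> (\int[mu]_x f x <= \int[mu]_x g x)%E.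
Proof.
move=> fg; rewrite /integral !patch_setT; apply: leeB.
- apply: le_ereal_sup => _ [h hf <-]; exists h => // x.
  by rewrite (le_trans (hf x))// !funeposE ge_max !le_max fg lexx orbT.
- apply: le_ereal_sup => _ [h hf <-]; exists h => // x.
  by rewrite (le_trans (hf x))// !funenegE ge_max !le_max leeN2 fg lexx orbT.
Qed.

(** Since [f] is arbitrary, the change on the null set is made to the measurable [g], whose integral
    it preserves. *)
Lemma ae_le_integral_measurable d (T : measurableType d) (R : realType)
    (mu : {measure set T -> \bar R}) (W : set T) (f g : T -> \bar R) :
  measurable W -> mu (~` W) = 0%E -> measurable_fun setT g ->
  (forall x, W x -> g x <= f x)%E -> (\int[mu]_x g x <= \int[mu]_x f x)%E.
Proof.
move=> mW W0 mg gf.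
(* The value -oo on a null set makes [g'] a lower bound of [f] everywhere. *)
pose g' x := if x \in W then g x else -oo%E.
have -> : (\int[mu]_x g x = \int[mu]_x g' x)%E.
  apply: ae_eq_integral => //.
  - apply: measurable_fun_if => //.
    + by apply: (measurable_fun_bool true); rewrite setTI (_ : _ @^-1` _ = W)//;
        apply/seteqP; split=> x /= => [/set_mem|/mem_set].
    + exact: (measurable_funS measurableT).
  - exists (~` W); split => //; first exact: measurableC.
    by move=> x /= + Wx; apply => _; rewrite /g' mem_set.
apply: le_integral_pointwise => x; rewrite /g'; case: ifPn => [/set_mem/gf//|_].
by rewrite leNye.
Qed.

Lemma indic_pred (R : pzRingType) (T : Type) (Q : pred T) (z : T) :
  \1_[set z | Q z] z = (Q z)%:R :> R.
Proof.
by rewrite indicE; congr (nat_of_bool _)%:R; apply/idP/idP => [/set_mem|/mem_set].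
Qed.

Lemma integral_affine_indicator d (T : measurableType d) (R : realType)
    (P : probability T R) (Q : pred T) (q c e : R) :
  measurable [set z | Q z] -> P [set z | Q z] = q%:E ->
  (\int[P]_z (c + e * (Q z)%:R)%:E = (c + e * q)%:E)%E.
Proof.
move=> mQ PQ.
under eq_integral do rewrite -indic_pred EFinD EFinM.
have iQ : P.-integrable setT (fun x => (\1_[set z | Q z] x)%:E).
  exact: integrable_indic.
rewrite integralD//=.
- rewrite integral_cst// [X in (_ * X + _)%E](_ : _ = 1%E); last exact: probability_setT.
  rewrite mule1 integralZl//.
  rewrite integral_indic// setIT EFinD EFinM; congr (_ + _ * _)%E; exact: PQ.
- exact: finite_measure_integrable_cst.
- exact: integrableZl.
Qed.

(** Integrating out one sample point turns [Q z] into [q] and leaves a bound affine in the count of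
    the others. The induction varies [c], which absorbs the term of the point already drawn. *)
Lemma iter_int_ge d (T : measurableType d) (R : realType)
    (P : probability T R) (Q : pred T) (W : set T) (q c e : R) (n : nat)
    (F : seq T -> \bar R) :
  measurable [set z | Q z] -> P [set z | Q z] = q%:E ->
  measurable W -> P (~` W) = 0%E ->
  (forall s, size s = n -> (forall z, z \in s -> W z) ->
    ((c + e * (count Q s)%:R)%:E <= F s)%E) ->
  ((c + e * (n%:R * q))%:E <= iter_int P n F)%E.
Proof.
move=> mQ PQ mW W0; elim: n c F => [|n IH] c F sF /=.
  by rewrite mul0r; apply: (sF [::]).
apply: (@le_trans _ _
    (\int[P]_z ((c + e * (n%:R * q)) + e * (Q z)%:R)%:E)%E).
  rewrite (integral_affine_indicator _ _ mQ PQ) lee_fin -natr1.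
  by rewrite mulrDl mul1r mulrDr addrA.
apply: (ae_le_integral_measurable mW W0) => [|z Wz].
  have -> : (fun z => (c + e * (n%:R * q) + e * (Q z)%:R)%:E) =
    (fun z => ((c + e * (n%:R * q)) + e * (\1_[set z | Q z] z))%:E).
    by apply/funext => z; rewrite indic_pred.
  apply/measurable_EFinP; apply: measurable_funD => //.
  by apply: measurable_funM => //; exact: measurable_indic.
rewrite addrAC; apply: IH => s sn sW.
rewrite -addrA -mulrDr -natrD; apply: (sF (z :: s)) => /= [|y]; first by rewrite sn.
by rewrite inE => /predU1P[->//|]; exact: sW.
Qed.

(** * The vote among equidistant sample points *)

Lemma count_constant (T : eqType) (a : pred T) (b : bool) (s : seq T) :
  (forall z, z \in s -> a z = b) -> count a s = (b * size s)%N.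
Proof.
move=> ab; rewrite (eq_in_count (a2 := fun=> b)) => [|z zs]; last exact: ab.
by case: b {ab}; rewrite ?mul1n ?mul0n ?count_predT ?count_pred0.
Qed.

(** Absorption, [j * C(t, j) = t * C(t - 1, j - 1)], reduces the sum to Vandermonde's identity. *)
Lemma hypergeometric_mean (t u m : nat) :
  (\sum_(0 <= j < m.+2) j * ('C(t, j) * 'C(u, m.+1 - j)) =
   t * 'C((t + u).-1, m))%N.
Proof.
rewrite big_nat_recl// mul0n add0n.
case: t => [|t].
  by rewrite mul0n big1_seq// => j _; rewrite bin0n mul0n muln0.
rewrite addSn /= -binomial.Vandermonde big_distrr /= big_mkord.
apply: eq_bigr => j _.
by rewrite mulnA -mul_bin_diag subSS mulnA.
Qed.

Section knn.
Variables (R : realType) (T : eqType) (dist : T -> T -> R).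

Lemma knn_prob1_ge0 k s x : 0 <= knn_prob1 dist k s x.
Proof. by rewrite /knn_prob1; apply: sumr_ge0 => j _; rewrite divr_ge0. Qed.

Lemma knn_radius_sphere (k : nat) (s : seq (T * bool)) (x : T) (r : R) :
  (0 < k)%N -> (k <= size s)%N -> 0 <= r ->
  (forall z, z \in s -> dist x z.1 = r) -> knn_radius dist k s x = r.
Proof.
move=> k0 ks r0 sr; rewrite /knn_radius.
have -> : [set rho : R | 0 <= rho /\
    (k <= count (fun z => (dist x z.1 <= rho)%R) s)%N] = `[r, +oo[%classic.
  apply/seteqP; split=> rho /=; rewrite in_itv/= andbT.
    move=> [_]; rewrite (count_constant (b := r <= rho)) => [|z /sr ->//].
    by case: (r <= rho) => //; rewrite mul0n leqNgt k0.
  move=> rrho; split; first exact: le_trans rrho.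
  by rewrite (count_constant (b := true)) ?mul1n// => z /sr ->.
by rewrite inf_itv.
Qed.

(* Markov's inequality: the [k] selected points carry [k * t1 / n] labels 1 in the mean, and the prediction 1 needs [k / 2] of them. *)
Lemma knn_prob1_sphere_le (k : nat) (s : seq (T * bool)) (x : T) (r : R) :
  (0 < k)%N -> (k <= size s)%N -> 0 <= r ->
  (forall z, z \in s -> dist x z.1 = r) ->
  knn_prob1 dist k s x <= 2 * (count snd s)%:R / (size s)%:R.
Proof.
move=> k0 ks r0 sr; rewrite /knn_prob1 (knn_radius_sphere k0 ks r0 sr).
have -> : count (fun z => dist x z.1 < r) s = 0%N.
  by rewrite (count_constant (b := false)) // => z /sr ->; rewrite ltxx.
have -> : count (fun z => (dist x z.1 < r) && z.2) s = 0%N.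
  by rewrite (count_constant (b := false)) // => z /sr ->; rewrite ltxx.
have -> : count (fun z => dist x z.1 == r) s = size s.
  by rewrite (count_constant (b := true)) ?mul1n// => z /sr ->; rewrite eqxx.
have -> : count (fun z => (dist x z.1 == r) && z.2) s = count snd s.
  by apply: eq_in_count => z /sr ->; rewrite eqxx.
rewrite subn0.
set t := count snd s; set n := size s in ks *.
have tn : (t <= n)%N by exact: count_size.
have Cn0 : (0 : R) < 'C(n, k)%:R by rewrite ltr0n bin_gt0.
have n0 : (0 : R) < n%:R by rewrite ltr0n (leq_trans k0).
have kR : (0 : R) < k%:R by rewrite ltr0n.
(* Every [j] kept by the vote satisfies [1 <= 2 * j / k]; the indices added by lifting the
   restriction contribute nonnegative terms. *)
apply: (@le_trans _ _ (\sum_(0 <= j < k.+1)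
   (2 / k%:R / 'C(n, k)%:R) * (j * ('C(t, j) * 'C(n - t, k - j)))%:R)).
  rewrite big_mkcond /=; apply: ler_sum => j _; case: ifPn => [kj|_]; last first.
    by rewrite mulr_ge0// !divr_ge0.
  set X := ('C(t, j) * _)%N.
  rewrite [(j * X)%:R]natrM [leRHS]mulrA [leLHS]mulrC ler_wpM2r//.
  rewrite mulrAC ler_peMl ?invr_ge0 ?ler0n// mulrAC ler_pdivlMr// mul1r.
  by rewrite -natrM ler_nat.
rewrite -mulr_sumr -natr_sum; case: k k0 ks Cn0 kR => // k _ kn Cn0 kR.
rewrite hypergeometric_mean subnKC//.
have e : (n * 'C(n.-1, k) = k.+1 * 'C(n, k.+1))%N.
  by case: (n) kn => // n' _; rewrite mul_bin_diag.
rewrite le_eqVlt; apply/orP; left; apply/eqP.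
apply: (mulfI (lt0r_neq0 n0)).
rewrite natrM [RHS]mulrC divfK ?lt0r_neq0//.
have -> : n%:R * (2 / k.+1%:R / 'C(n, k.+1)%:R * (t%:R * 'C(n.-1, k)%:R)) =
  (2 * t%:R) * ((n * 'C(n.-1, k))%:R / (k.+1 * 'C(n, k.+1))%:R) :> R.
  by rewrite !natrM invfM; ring.
by rewrite e divff ?mulr1// natrM mulf_neq0 ?lt0r_neq0.
Qed.

End knn.

(** * Two-valued probabilities on metric spaces *)

Section measure_probability.
Context d (T : measurableType d) (R : realType) (m : {measure set T -> \bar R}).
Hypothesis mT : m setT = 1%E.

(** The proof of total mass one is an argument of the alias, so that a probability instance can be
    attached to it. *)
Definition measure_as_probability of m setT = 1%E : set T -> \bar R := m.

HB.instance Definition _ := Measure.on (measure_as_probability mT).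
HB.instance Definition _ := Measure_isProbability.Build _ _ _
  (measure_as_probability mT) mT.

Lemma measure_probability : exists P : probability T R, forall A, P A = m A.
Proof. by exists (measure_as_probability mT). Qed.

End measure_probability.

Lemma probability_mixture d (T : measurableType d) (R : realType)
    (P1 P2 : probability T R) (q : R) : 0 <= q -> q <= 1 ->
  exists P : probability T R,
    forall A, P A = ((1 - q)%:E * P1 A + q%:E * P2 A)%E.
Proof.
move=> q0 q1; have q1' : 0 <= 1 - q by rewrite subr_ge0.
pose m := measure_add (mscale (NngNum q1') P1) (mscale (NngNum q0) P2).
have mE A : m A = ((1 - q)%:E * P1 A + q%:E * P2 A)%E by rewrite /m measure_addE.
have mT : m setT = 1%E.
  by rewrite mE !probability_setT !mule1 -EFinD subrK.
by have [P PE] := measure_probability mT; exists P => A; rewrite PE.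
Qed.

Section two_valued_pushforward.
Variables (R : realType) (K : Type) (nu : set K -> R).
Hypothesis nu01 : forall A, nu A = 0 \/ nu A = 1.
Hypothesis nuT : nu setT = 1.
Hypothesis nu_additive : forall F : (set K)^nat, trivIset setT F ->
  (fun n => \sum_(0 <= i < n) nu (F i)) @ \oo --> nu (\bigcup_i F i).

(** For the constant sequence of empty sets, the value 1 would make the partial sums converge to 1
    and their shift to 2. *)
Lemma two_valued_measure0 : nu set0 = 0.
Proof.
case: (nu01 set0) => // nu1.
have F0 : trivIset setT (fun _ : nat => set0 : set K).
  by move=> i j _ _ [x []].
have := nu_additive F0; rewrite bigcup0// nu1 => cv.
have cv1 := cv; rewrite -(cvg_shiftS _) /= in cv1.
have cv2 : (fun n => \sum_(0 <= i < n.+1) (1 : R)) @ \oo --> (1 + 1 : R).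
  under eq_fun do rewrite big_nat_recr//=.
  by apply: cvgD => //; exact: cvg_cst.
have /eqP : (1 : R) = 1 + 1 by exact: (cvg_unique _ cv1 cv2).
by rewrite -subr_eq subrr eq_sym oner_eq0.
Qed.

(** As [nu] is defined on all subsets of [K], every map [g] can be used. *)
Lemma two_valued_pushforward d (T : measurableType d) (g : K -> T) :
  exists P : probability T R, forall A, P A = (nu (g @^-1` A))%:E.
Proof.
pose m (A : set T) : \bar R := (nu (g @^-1` A))%:E.
have m0 : m set0 = 0%E by rewrite /m preimage_set0 two_valued_measure0.
have mge0 A : (0 <= m A)%E by rewrite lee_fin; case: (nu01 (g @^-1` A)) => ->.
have madd : semi_sigma_additive m.
  move=> F mF tF _; rewrite /m preimage_bigcup.
  under eq_fun do rewrite sumEFin.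
  apply: cvg_EFin; first exact: nearW.
  apply: (nu_additive (F := fun i => g @^-1` F i)).
  by move=> i j _ _ [x [Fi Fj]]; apply: tF => //; exists (g x).
have mT : m setT = 1%E by rewrite /m preimage_setT nuT.
pose M : {measure set T -> \bar R} := HB.pack m (isMeasure.Build _ _ _ m m0 mge0 madd).
by have [P PE] := @measure_probability _ _ _ M mT; exists P => A; rewrite PE.
Qed.

End two_valued_pushforward.

Section probability_one.
Context d (T : measurableType d) (R : realType) (P : probability T R).

Lemma probability1_setC (A : set T) : measurable A -> P A = 1%E -> P (~` A) = 0%E.
Proof. by move=> mA PA; rewrite probability_setC// PA subee. Qed.

Lemma probability1_nonempty (A : set T) : P A = 1%E -> A !=set0.
Proof.
move=> PA; apply/set0P/eqP => A0; move: PA; rewrite A0 measure0 => /eqP.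
by rewrite eq_sym onee_eq0.
Qed.

Lemma probability1_setI (A B : set T) : measurable A -> measurable B ->
  P A = 1%E -> P B = 1%E -> P (A `&` B) = 1%E.
Proof.
move=> mA mB PA PB; rewrite -[A `&` B]setCK setCI probability_setC; last first.
  by apply: measurableU; exact: measurableC.
have AB0 : P (~` A `|` ~` B) = 0%E.
  apply: etrans (measureU0 (measurableC mA) (measurableC mB) _) _.
    exact: probability1_setC.
  exact: probability1_setC.
by rewrite AB0 sube0.
Qed.

Hypothesis P01 : forall A, measurable A -> P A = 0%E \/ P A = 1%E.

(* Off the null set cut out by the rational sublevel sets of [h], two values of [h] cannot be separated by a rational. *)
Lemma two_valued_ae_constant (h : T -> R) : measurable_fun setT h ->
  exists r, P (h @^-1` [set r]) = 1%E.
Proof.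
move=> mh.
have mle t : measurable [set x | h x <= t].
  rewrite [X in measurable X](_ : _ = setT `&` h @^-1` `]-oo, t]); first exact: mh.
  by rewrite setTI; apply/seteqP; split => x /=; rewrite in_itv.
pose L (q : rat) := [set x | h x <= ratr q].
(* Decoding naturals as rationals reduces the conditions to countably many. *)
have := @ae_foralln _ _ _ P (fun n x => forall q, unpickle n = Some q ->
  (P (L q) = 0%E -> ~ L q x) /\ (P (L q) = 1%E -> L q x)).
case=> [n|A [mA PA AP]].
  case: (unpickle n) => [q|]; last first.
    by exists set0; split => //; move=> x /= [].
  have [Pq|Pq] := P01 (mle (ratr q)).
    exists (L q); split; [exact: mle|exact: Pq|].
    move=> x /= /existsNP[q' /not_implyP[[<-]]] H; apply: contrapT => nL; apply: H.
    by split => //; rewrite Pq => /eqP; rewrite eq_sym onee_eq0.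
  exists (~` L q); split; [exact: measurableC (mle _)|exact: probability1_setC (mle _) Pq|].
  move=> x /= /existsNP[q' /not_implyP[[<-]]] H; apply: contra_not H => Lx.
  by split => //; rewrite Pq => /eqP; rewrite onee_eq0.
have PA1 : P (~` A) = 1%E by rewrite probability_setC// PA sube0.
have gA x : (~` A) x -> forall q,
    (P (L q) = 0%E -> ~ L q x) /\ (P (L q) = 1%E -> L q x).
  move=> Ax q; have := contra_not (AP x) Ax => /= /contrapT /(_ (pickle q)); apply.
  by rewrite pickleK.
have [x Ax] := probability1_nonempty PA1.
have ltF y z : (~` A) y -> (~` A) z -> h y < h z -> False.
  move=> /gA Ay /gA Az /rat_in_itvoo[q]; rewrite in_itv/= => /andP[yq qz].
  have [P0|P1] := P01 (mle (ratr q)).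
    by apply: (Ay q).1 P0 _; rewrite /L /= ltW.
  by have := (Az q).2 P1; rewrite /L/= leNgt qz.
exists (h x); apply/eqP; rewrite eq_le; apply/andP; split.
  by apply: probability_le1; rewrite -[_ @^-1` _]setTI; exact: mh.
rewrite -PA1; apply: le_measure; rewrite ?inE//; first exact: measurableC.
  by rewrite -[_ @^-1` _]setTI; exact: mh.
by move=> y Ay /=; have [/ltF|/ltF|//] := ltgtP (h y) (h x); tauto.
Qed.

End probability_one.

Section two_valued_metric.
Context d (T : measurableType d) (R : realType) (dist : T -> T -> R).
Hypotheses (metric_dist : is_metric dist) (borel_dist : is_borel dist).

Lemma borel_measurable_fun (f : T -> R) :
  (forall t, metric_open dist [set x | f x < t]) -> measurable_fun setT f.
Proof.
move=> fo; apply: (measurability (@RGenInftyO.G R)).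
  exact: RGenInftyO.measurableE.
move=> _ [_ [t ->] <-]; apply/borel_dist; apply: sub_sigma_algebra.
rewrite setTI /= (_ : _ @^-1` _ = [set x | f x < t]); first exact: fo.
by apply/seteqP; split => x /=; rewrite in_itv.
Qed.

(** Sublevel sets are open: the ball of radius [t - f x] about [x] stays in [f < t]. *)
Lemma nonexpansive_measurable (f : T -> R) :
  (forall x y, f y <= f x + dist x y) -> measurable_fun setT f.
Proof.
move=> f1; apply: borel_measurable_fun => t x /= fxt; exists (t - f x).
  by rewrite subr_gt0.
by move=> y /= xy; rewrite (le_lt_trans (f1 x y))// addrC -ltrBrDr.
Qed.

Lemma measurable_dist x : measurable_fun setT (dist x).
Proof. by case: metric_dist => _ _ _ tri; exact: nonexpansive_measurable. Qed.

Lemma measurable_sphere x r : measurable (dist x @^-1` [set r]).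
Proof. by rewrite -[_ @^-1` _]setTI; exact: measurable_dist. Qed.

Lemma two_valued_equidistant (P : probability T R) :
  (forall A, measurable A -> P A = 0%E \/ P A = 1%E) ->
  exists (r : R) (G : set T), [/\ 0 <= r, measurable G, P G = 1%E &
    forall x, G x -> P (dist x @^-1` [set r]) = 1%E].
Proof.
move=> P01; case: (metric_dist) => d0 _ dC tri.
have /choice[rad radP] : forall x, exists r, P (dist x @^-1` [set r]) = 1%E.
  by move=> x; apply: two_valued_ae_constant => //; exact: measurable_dist.
have mrad : measurable_fun setT rad.
  (* The spheres of radius [rad x] about [x] and [rad y] about [y] have measure one, so they share a
     point [z], through which the triangle inequality is applied. *)
  apply: nonexpansive_measurable => x y.
  have [z [/= <- <-]] := probability1_nonempty
    (probability1_setI (measurable_sphere _ _) (measurable_sphere _ _)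
      (radP x) (radP y)).
  by rewrite addrC (dC x y).
have [r radr] := two_valued_ae_constant P01 mrad.
exists r, (rad @^-1` [set r]); split => //.
- have [x /= <-] := probability1_nonempty radr.
  by have [y /= <-] := probability1_nonempty (radP x).
- by rewrite -[_ @^-1` _]setTI; exact: mrad.
- by move=> x /= <-.
Qed.

(** By symmetry of [dist], these queries include a finite intersection of measure-one spheres about
    the sample points. The set [E] depends on the sample, which is fixed first. *)
Lemma equidistant_from_list (P : probability T R) (r : R) (G : set T)
    (s : seq (T * bool)) :
  (forall x, G x -> P (dist x @^-1` [set r]) = 1%E) ->
  (forall z, z \in s -> G z.1) ->
  exists E : set T, [/\ measurable E, P E = 1%E &
    forall x, E x -> forall z, z \in s -> dist x z.1 = r].
Proof.
case: (metric_dist) => _ _ dC _ Gr; elim: s => [_|z s IH sG].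
  by exists setT; split => //; exact: probability_setT.
have [|E [mE PE Es]] := IH; first by move=> y ys; apply: sG; rewrite inE ys orbT.
have Pz : P (dist z.1 @^-1` [set r]) = 1%E by apply/Gr/sG; rewrite mem_head.
exists (dist z.1 @^-1` [set r] `&` E); split.
- by apply: measurableI => //; exact: measurable_sphere.
- by apply: probability1_setI => //; exact: measurable_sphere.
- move=> x [/= zx Ex] y; rewrite inE => /predU1P[->|]; last exact: Es.
  by rewrite dC.
Qed.

End two_valued_metric.

(** * Errors of the classifier and of the Bayes rule *)

Section knn_error_bound.
Context d (T : measurableType d) (R : realType) (dist : T -> T -> R).
Context (mu : probability (T * bool)%type R) (P : probability T R).
Context (r q : R) (G : set T).
Hypotheses (metric_dist : is_metric dist) (borel_dist : is_borel dist).
Hypotheses (r0 : 0 <= r) (mG : measurable G).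
Hypothesis Gr : forall x, G x -> P (dist x @^-1` [set r]) = 1%E.
Hypothesis mu1 : mu [set z : T * bool | z.2] = q%:E.
Hypothesis muG : mu (~` [set z : T * bool | G z.1]) = 0%E.
Hypothesis mu0 : forall E, measurable E -> P E = 1%E ->
  mu (~` [set z : T * bool | z.2 -> E z.1]) = 0%E.

Lemma measurable_label : measurable [set z : T * bool | z.2].
Proof.
rewrite (_ : [set _ | _] = setT `&` snd @^-1` [set true]).
  exact: measurable_snd.
by rewrite setTI; apply/seteqP; split => -[x []].
Qed.

Lemma measurable_fst_preimage (E : set T) : measurable E ->
  measurable [set z : T * bool | E z.1].
Proof.
move=> mE; rewrite (_ : [set _ | _] = setT `&` fst @^-1` E) ?setTI//.
by rewrite -[X in measurable X]setTI; exact: measurable_fst.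
Qed.

Lemma measurable_label_imply (E : set T) : measurable E ->
  measurable [set z : T * bool | z.2 -> E z.1].
Proof.
move=> mE; rewrite (_ : [set _ | _] =
    ~` [set z : T * bool | z.2] `|` [set z | E z.1]).
  apply: measurableU; last exact: measurable_fst_preimage.
  exact: measurableC measurable_label.
apply/seteqP; split => -[x b] /=; last by case.
by case: b => [/(_ isT)|_]; [right|left].
Qed.

(** Queries labelled false are bounded below by 0; almost all those labelled true see the whole
    sample on one sphere. The bound is affine in the count, as [iter_int_ge] requires. *)
Lemma knn_sample_loss_ge (k : nat) (s : seq (T * bool)) :
  (0 < k)%N -> (k <= size s)%N -> (forall z, z \in s -> G z.1) ->
  ((q + - (2 * q / (size s)%:R) * (count snd s)%:R)%:E <=
   \int[mu]_z (knn_loss dist k s z)%:E)%E.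
Proof.
move=> k0 ks sG.
have [E [mE PE Es]] := equidistant_from_list metric_dist borel_dist Gr sG.
have -> : q + - (2 * q / (size s)%:R) * (count snd s)%:R =
    0 + (1 - 2 * (count snd s)%:R / (size s)%:R) * q by ring.
rewrite -(integral_affine_indicator _ _ measurable_label mu1).
apply: (ae_le_integral_measurable (measurable_label_imply mE) (mu0 mE PE)).
  apply/measurable_EFinP; apply: measurable_funD => //.
  apply: measurable_funM => //.
  under eq_fun do rewrite -(indic_pred _ snd).
  exact: measurable_indic measurable_label.
move=> [x b] /= Exb; rewrite lee_fin /knn_loss add0r; case: b Exb => /= Ex.
  rewrite mulr1 lerD2l lerN2.
  by apply: (@knn_prob1_sphere_le _ _ dist k s x r) => // z; apply: Es; exact: Ex.
by rewrite mulr0 knn_prob1_ge0.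
Qed.

(** The count of labels true has mean [n * q], so the factor [1 / n] cancels and the bound does not
    depend on [n]. *)
Lemma knn_err_ge (k : nat -> nat) (n : nat) : (0 < k n)%N -> (k n <= n)%N ->
  ((q * (1 - 2 * q))%:E <= knn_err dist mu k n)%E.
Proof.
move=> k0 kn; have n0 : (n%:R : R) != 0.
  by rewrite pnatr_eq0 -lt0n (leq_trans k0).
have -> : q * (1 - 2 * q) = q + - (2 * q / n%:R) * (n%:R * q) by field.
apply: (iter_int_ge measurable_label mu1 (measurable_fst_preimage mG) muG).
by move=> s sn sG; rewrite -sn; apply: knn_sample_loss_ge => //; rewrite sn.
Qed.

End knn_error_bound.

Lemma bayes_error_le0 d (T : measurableType d) (R : realType)
    (mu : probability (T * bool)%type R) (x0 : T) :
  measurable [set x0] -> mu [set z | (z.1 != x0) != z.2] = 0%E ->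
  (bayes_error mu <= 0)%E.
Proof.
move=> mx0 mu0; apply: ereal_inf_lbound; exists (fun x => x != x0) => //=.
apply: (measurable_fun_bool false); rewrite setTI.
rewrite (_ : _ @^-1` _ = [set x0])//.
by apply/seteqP; split => x /=; [move/negbFE/eqP|move=> ->; rewrite eqxx].
Qed.

(** * The mixture of an atom and a two-valued measure *)

Theorem mainTheorem9 (R : realType) (K : Type) (d : measure_display)
  (Omega : measurableType d) (dist : Omega -> Omega -> R)
  (k : nat -> nat) :
  two_valued_measurable R K ->
  type_card_le K Omega ->
  is_metric dist ->
  is_borel dist ->
  k n @[n --> \oo] --> \oo ->
  (k n)%:R / n%:R @[n --> \oo] --> (0 : R) ->
  ~ knn_universally_consistent dist k.
Proof.
move=> [nu [nu01 nuT nuD nu1 _]] [f finj] mdist bdist koo kn0 consistent.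
have [P PE] := two_valued_pushforward nu01 nuT nuD f.
have [P1 P1E] := two_valued_pushforward nu01 nuT nuD (fun x => (f x, true)).
have nu0 := two_valued_measure0 nu01 nuD.
have P01 A : measurable A -> P A = 0%E \/ P A = 1%E.
  by move=> _; rewrite PE; case: (nu01 (f @^-1` A)) => ->; [left|right].
have [r [G [r0 mG PG Gr]]] := two_valued_equidistant mdist bdist P01.
(* With the atom in [G], sample points drawn from it also lie at distance [r] from almost every
   query. *)
have [x0 Gx0] := probability1_nonempty PG.
have [_ deq _ _] := mdist.
have mx0 : measurable [set x0].
  rewrite (_ : [set x0] = dist x0 @^-1` [set 0]); first exact: measurable_sphere.
  by apply/seteqP; split => x /=; rewrite deq.
(* Injectivity of [f] leaves at most one point in the preimage. *)
have nux0 : nu (f @^-1` [set x0]) = 0.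
  have [[y fy]|nf] := pselect (exists y, f y = x0); last first.
    rewrite (_ : _ @^-1` _ = set0)//; apply/seteqP; split => // y /= fy.
    by apply: nf; exists y.
  rewrite (_ : _ @^-1` _ = [set y])//; apply/seteqP; split => y' /=; last by move=> ->.
  by rewrite -fy => /finj.
(* The value 1/4 maximises [q * (1 - 2 * q)]. *)
pose q : R := 4^-1.
have q0 : 0 <= q by rewrite invr_ge0.
have q1 : q <= 1 by rewrite /q; lra.
have [mu muE] := probability_mixture (\d_(x0, false) : probability _ R) P1 q0 q1.
have muF A : ~ A (x0, false) -> mu A = (q * nu (fun x => A (f x, true)))%:E.
  move=> nA; have -> : mu A = ((1 - q)%:E * \d_(x0, false) A + q%:E * P1 A)%E.
    exact: muE.
  by rewrite diracE memNset// mule0 add0e P1E.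
have PnuC E : measurable E -> P E = 1%E -> nu (f @^-1` (~` E)) = 0.
  by move=> mE /(probability1_setC mE); rewrite PE => -[].
have err n : (0 < k n)%N -> (k n <= n)%N ->
    ((q * (1 - 2 * q))%:E <= knn_err dist mu k n)%E.
  apply: (knn_err_ge mdist bdist r0 mG Gr).
  - rewrite muF//= (_ : (fun _ => _) = setT) ?nuT ?mulr1//.
    by apply/seteqP; split.
  - by rewrite muF/= ?(PnuC _ mG PG) ?mulr0//; apply.
  - move=> E mE PE1; rewrite muF/=; last by apply.
    rewrite (_ : (fun _ => _) = f @^-1` (~` E)) ?PnuC ?mulr0//.
    by apply/seteqP; split => x /=; [move=> H /(fun e _ => e)/H|move=> H /(_ isT)/H].
have bayes : (bayes_error mu <= 0)%E.
  apply: (bayes_error_le0 mx0); rewrite muF/= ?eqxx//.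
  rewrite (_ : (fun _ => _) = f @^-1` [set x0]) ?nux0 ?mulr0//.
  apply/seteqP; split => x /=; last by move=> ->; rewrite eqxx.
  by rewrite eqb_id negbK => /eqP.
have kpos : \forall n \near \oo, (0 < k n)%N by exact: (koo _ (nbhs_infty_gt 0)).
have : ((q * (1 - 2 * q))%:E <= bayes_error mu)%E.
  apply: cvge_to_ge (consistent mu) _.
  near=> n; apply: err.
    by near: n.
  (* A limit 0 of the ratio gives [k n < n] eventually; [n] must be positive, as division by zero
     yields 0. *)
  have kn1 : (k n)%:R / n%:R < 1 :> R.
    by near: n; apply: cvgr_lt kn0 _ ltr01.
  have n0 : (0 : R) < n%:R by rewrite ltr0n; near: n; exact: nbhs_infty_gt.
  by move: kn1; rewrite ltr_pdivrMr// mul1r ltr_nat => /ltnW.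
move=> /le_trans/(_ bayes); rewrite lee_fin /q; lra.
Unshelve. all: by end_near. Qed.
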